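(* Let $v_1(t),\dots,v_N(t)$ be a (differentiable in time) solution, on a time interval during which the batches are fixed, of the random batch particle system of type II $$\frac{\mathrm{d}v_i}{\mathrm{d}t}=-\frac{N-1}{p-1}\sum_{j=1}^N w_jI_{ij}A(v_i-v_j)\tilde B_{ij}^N,\qquad i=1,\dots,N,$$ where $\tilde B_{ij}^N=\nabla\frac{\delta\tilde E_\epsilon^N}{\delta f}(v_i)-\nabla\frac{\delta\tilde E_\epsilon^N}{\delta f}(v_j)$ and $$\nabla\frac{\delta\tilde E_\epsilon^N}{\delta f}(v)=\frac{\sum_{k=1}^N w_k\nabla\psi_\epsilon(v-v_k)}{\sum_{k=1}^N w_k\psi_\epsilon(v-v_k)}+\sum_{k=1}^N w_k\frac{\nabla\psi_\epsilon(v-v_k)}{\sum_{m=1}^N w_m\psi_\epsilon(v_k-v_m)} .$$ Then: 1. (Conservation of mass, momentum and energy) $\displaystyle\frac{\mathrm{d}}{\mathrm{d}t}\sum_{i=1}^N w_i\phi(v_i)=0$ for $\phi(v)=1$, $\phi(v)=v$ and $\phi(v)=|v|^2$. 2. (Dissipation of entropy) With $$\tilde E_\epsilon^N=\sum_{i=1}^N w_i\log\Big(\sum_{k=1}^N w_k\psi_\epsilon(v_i-v_k)\Big),$$ one has $\displaystyle\frac{\mathrm{d}\tilde E_\epsilon^N}{\mathrm{d}t}=-\tilde D_\epsilon^*\le0$, where $$\tilde D_\epsilon^*=\frac{N-1}{2(p-1)}\sum_{i=1}^N\sum_{j=1}^N w_iw_jI_{ij}\,\tilde B_{ij}^N\cdot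 A(v_i-v_j)\tilde B_{ij}^N .$$
   Context: Let $d\ge 2$, $\Lambda>0$, $-d-1\le\gamma\le 1$, and let $A(z)=\Lambda|z|^\gamma(|z|^2I_d-z\otimes z)$ for $z\in\mathbb{R}^d$; this is a symmetric positive semi-definite matrix with $A(z)=A(-z)$ and $A(z)z=0$. Let $\epsilon>0$ and let $\psi_\epsilon(v)=(2\pi\epsilon)^{-d/2}\exp(-|v|^2/(2\epsilon))$ on $\mathbb{R}^d$. $N$ particles have velocities $v_i(t)\in\mathbb{R}^d$ and time-independent weights $w_i>0$. The index set $\{1,\dots,N\}$ is partitioned into $q=N/p$ batches, each of size $p$ ($2\le p\le N$, $p$ divides $N$). In the method the partition is drawn at random at the beginning of each time step and kept fixed during that step; the statement holds for every partition. The indicator is $I_{ij}=1$ if $i,j$ are in the same batch and $I_{ij}=0$ otherwise (so $I_{ij}=I_{ji}$). Convention: when $v_i=v_j$ (in particular when $i=j$), in which case $\tilde B_{ij}^N=0$, the expression $A(v_i-v_j)\tilde B_{ij}^N$ is taken to be $0$. *)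

(* Defs.v *)
From HB Require Import structures.
From mathcomp Require Import all_boot all_order all_algebra.
From mathcomp Require Import all_classical all_reals all_analysis.
Set Implicit Arguments.
Unset Strict Implicit.
Unset Printing Implicit Defensive.
Import Order.TTheory GRing.Theory Num.Theory.
Import numFieldNormedType.Exports.
Local Open Scope classical_set_scope.
Local Open Scope ring_scope.

(* Derivative of a curve relative to its time domain [J]: one-sided at an
   endpoint belonging to [J], the usual derivative in the interior
   ([derives_withinP]). *)
Definition derives_within (R : realType) (V : normedModType R)
    (J : set R) (f : R -> V) (t : R) (df : V) : Prop :=
  h^-1 *: (f (h + t) - f t) @[h --> within [set h | J (h + t)] 0^'] --> df.

Lemma derives_withinP (R : realType) (V : normedModType R)
    (J : set R) (f : R -> V) (t : R) (df : V) :
  nbhs t J -> derives_within J f t df <-> is_derive t 1 f df.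
Proof.
move=> Jt.
have nJ : within [set h | J (h + t)] 0^' = 0^' :> set_system R.
  apply/funext => P; apply/propext; rewrite /within; split=> /= HP; last first.
    by apply: filterS HP.
  have Dt : (h + t) @[h --> (0 : R)] --> t.
    by rewrite -[X in _ --> X]add0r; exact: (cvgD cvg_id (cvg_cst t)).
  have {}Jt : \forall h \near 0^', J (h + t) by apply: cvg_within; exact: Dt.
  by apply: filterS2 Jt HP => h Jh; apply.
have E : (fun h => h^-1 *: (f (h + t) - f t)) =
    (fun h => h^-1 *: ((f \o shift t) (h *: 1) - f t)).
  by apply/funext => h /=; rewrite [h *: 1]mulr1.
rewrite /derives_within nJ E; split=> [fdf|[fd <-] //].
split; first by apply/cvg_ex; exists df.
by apply: cvg_lim => //; exact: fdf.
Qed.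

Section euclidean.
Context {R : realType} {d : nat}.
Implicit Types u z : 'cV[R]_d.

Definition dotv u z : R := \sum_k u k 0 * z k 0.

(* The norm [`|z|] of the library is the sup norm on matrices. *)
Definition enorm z : R := Num.sqrt (dotv z z).

Definition grad (f : 'cV[R]_d -> R) z : 'cV[R]_d :=
  \col_k 'D_(delta_mx k 0) f z.

(* At z = 0 the matrix factor is 0, hence so is [landauA] for every gamma. *)
Definition landauA (Lambda gamma : R) z : 'M[R]_d :=
  (Lambda * enorm z `^ gamma) *: ((enorm z ^+ 2)%:M - z *m z^T).

Definition psi (eps : R) z : R :=
  (2 * pi * eps) `^ (- (d%:R / 2)) * expR (- (enorm z ^+ 2 / (2 * eps))).

End euclidean.

Section particles.
Context {R : realType} {d N : nat}.
Variables (eps : R) (w : 'I_N -> R).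
Implicit Types (v : 'I_N -> 'cV[R]_d) (x : 'cV[R]_d).

Definition density v x : R := \sum_k w k * psi eps (x - v k).

Definition grad_dE v x : 'cV[R]_d :=
  (density v x)^-1 *: (\sum_k w k *: grad (psi eps) (x - v k))
  + \sum_k w k *: ((density v (v k))^-1 *: grad (psi eps) (x - v k)).

Definition Btilde v (i j : 'I_N) : 'cV[R]_d :=
  grad_dE v (v i) - grad_dE v (v j).

Definition entropy v : R := \sum_i w i * ln (density v (v i)).

Definition is_batching (p : nat) (P : {set {set 'I_N}}) : Prop :=
  finset.partition P [set: 'I_N]%SET /\
  forall B : {set 'I_N}, B \in P -> #|B| = p.

Definition same_batch (P : {set {set 'I_N}}) (i j : 'I_N) : R :=
  [exists B in P, (i \in B) && (j \in B)]%:R.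

Variables (Lambda gamma : R) (p : nat) (P : {set {set 'I_N}}).

Definition batch_velocity v (i : 'I_N) : 'cV[R]_d :=
  - (((N%:R - 1) / (p%:R - 1)) *:
     \sum_j (w j * same_batch P i j) *:
       (landauA Lambda gamma (v i - v j) *m Btilde v i j)).

Definition dissipation v : R :=
  (N%:R - 1) / (2 * (p%:R - 1)) *
  \sum_i \sum_j w i * w j * same_batch P i j *
    dotv (Btilde v i j) (landauA Lambda gamma (v i - v j) *m Btilde v i j).

End particles.

(* Main.v *)
Require Import Defs.
From mathcomp Require Import all_boot all_order all_algebra.
From mathcomp Require Import all_classical all_reals all_analysis.
From mathcomp Require Import ring.
Set Implicit Arguments.
Unset Strict Implicit.
Unset Printing Implicit Defensive.
Import Order.TTheory GRing.Theory Num.Theory.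
Import numFieldNormedType.Exports.
Local Open Scope classical_set_scope.
Local Open Scope ring_scope.

(** The velocity field pairs the particles of a batch antisymmetrically.  Write
    [X i j] for [A(v_i - v_j)] applied to [Btilde i j].  As [A] is even and
    [Btilde] antisymmetric, [X j i = - X i j], and since the batch indicator is
    symmetric, exchanging the summation indices gives for any vectors [g i]
    the weak form ([batch_velocity_weak])

      sum_i w_i g_i . v_i' =
        - (N - 1) / (2 (p - 1)) sum_ij w_i w_j I_ij (g_i - g_j) . X i j.

    Everything follows from the choice of [g].  A constant [g] makes the right
    side vanish, which is conservation of momentum.  With [g i = v_i] it
    vanishes because [A z] is symmetric and kills [z]: conservation of energy.
    With [g i] the gradient of the variational derivative of the entropy at
    [v_i], [g i - g j] is [Btilde i j] and the right side is minus the
    dissipation.  It is nonpositive because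
    [b . A z b = Lambda |z|^gamma (|z|^2 |b|^2 - (z . b)^2)], which is
    nonnegative by the Cauchy-Schwarz inequality.

    It remains to see that the left side, for this last choice, is the time
    derivative of the entropy.  The chain rule gives a double sum over [i] and
    [k] of terms [grad psi (v_i - v_k) . (v_i' - v_k')]; as [psi] is even its
    gradient is odd, so the part with [v_k'] is brought to [v_i'] by exchanging
    [i] and [k], and this produces the second half of the gradient
    ([entropy_variation]).  The singularity of [A] at collisions is
    harmless: [A] enters only through the values of [v_i'], which are never
    differentiated. *)

(** * Differentiation relative to a time domain *)

Section within_derivative.
Context {R : realType}.
Implicit Types (J : set R) (t : R).

Lemma derives_within_sum {V : normedModType R} {n : nat} J t
    (f : 'I_n -> R -> V) (df : 'I_n -> V) :
  (forall i, derives_within J (f i) t (df i)) ->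
  derives_within J (fun s => \sum_i f i s) t (\sum_i df i).
Proof.
move=> fdf; rewrite /derives_within.
under eq_fun do rewrite -sumrB scaler_sumr.
by apply: cvg_big => [|i _]; [exact: add_continuous|exact: fdf].
Qed.

Lemma derives_withinZ {V : normedModType R} (a : R) J t (f : R -> V) (df : V) :
  derives_within J f t df ->
  derives_within J (fun s => a *: f s) t (a *: df).
Proof.
move=> fdf; rewrite /derives_within.
under eq_fun do rewrite -scalerBr scalerA mulrC -scalerA.
exact: cvgZl_tmp.
Qed.

Lemma derives_withinB {V : normedModType R} J t (f g : R -> V) (df dg : V) :
  derives_within J f t df -> derives_within J g t dg ->
  derives_within J (fun s => f s - g s) t (df - dg).
Proof.
move=> fdf gdg; rewrite /derives_within.
under eq_fun do rewrite opprD addrACA -opprD scalerBr.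
exact: cvgB.
Qed.

Lemma near_within_neq0 J t :
  \forall h \near within [set h | J (h + t)] 0^', h != 0.
Proof. exact: (cvg_within _ (nbhs_dnbhs_neq (0 : R))). Qed.

(** Continuity along the domain: the increment is [h] times the difference
    quotient, and [h] tends to 0. *)
Lemma derives_within_cvg {V : normedModType R} J t (f : R -> V) (df : V) :
  derives_within J f t df ->
  f (h + t) @[h --> within [set h | J (h + t)] 0^'] --> f t.
Proof.
move=> fdf.
have h0 : h @[h --> within [set h | J (h + t)] 0^'] --> (0 : R).
  exact: cvg_trans (cvg_within _) (cvg_within _).
have -> : f t = f t + 0 *: df by rewrite scale0r addr0.
apply: cvg_trans (cvgD (cvg_cst (f t)) (cvgZ h0 fdf)); apply: near_eq_cvg.
apply: filterS (near_within_neq0 J t) => h h_neq0.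
by rewrite fctE scalerA divff // scale1r addrC subrK.
Qed.

Lemma derives_withinM J t (f g : R -> R) (df dg : R) :
  derives_within J f t df -> derives_within J g t dg ->
  derives_within J (fun s => f s * g s) t (df * g t + f t * dg).
Proof.
move=> fdf gdg; rewrite /derives_within.
have -> : (fun h => h^-1 *: (f (h + t) * g (h + t) - f t * g t)) =
    (fun h => h^-1 *: (f (h + t) - f t) * g (h + t) +
              f t * (h^-1 *: (g (h + t) - g t))).
  by apply/funext => h; rewrite /GRing.scale /=; ring.
apply: cvgD; first by apply: cvgM; [exact: fdf|exact: derives_within_cvg gdg].
by apply: cvgM; [exact: cvg_cst|exact: gdg].
Qed.

(** Caratheodory's factorization [g z - g (f t) = q z * (z - f t)] avoids
    dividing by an increment of [f], which may vanish for [h] arbitrarily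
    small. *)
Lemma derives_within_comp J t (g f : R -> R) (dg df : R) :
  is_derive (f t) 1 g dg -> derives_within J f t df ->
  derives_within J (fun s => g (f s)) t (dg * df).
Proof.
move=> /is_derive1_caratheodory[q [gq q_cont <-]] fdf; rewrite /derives_within.
under eq_fun do rewrite gq scalerAr.
apply: cvgM; last exact: fdf.
exact: (cvg_comp _ _ (derives_within_cvg fdf) q_cont).
Qed.

Lemma derives_within_coord {d : nat} J t (u : R -> 'cV[R]_d) (du : 'cV[R]_d)
    (k : 'I_d) :
  derives_within J u t du ->
  derives_within J (fun s => u s k 0) t (du k 0).
Proof.
move=> udu; rewrite /derives_within.
have -> : (fun h => h^-1 *: (u (h + t) k 0 - u t k 0)) =
    (fun x : 'cV[R]_d => x k 0) \o (fun h => h^-1 *: (u (h + t) - u t)).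
  by apply/funext => h /=; rewrite !mxE.
exact: (cvg_comp _ _ udu (@coord_continuous _ _ _ k 0 du)).
Qed.

End within_derivative.

(** * The Euclidean inner product *)

Section dot_product.
Context {R : realType} {d : nat}.
Implicit Types (x y z : 'cV[R]_d) (a : R).

Lemma dotvE x y : dotv x y = (x^T *m y) 0 0.
Proof. by rewrite mxE; apply: eq_bigr => k _; rewrite mxE. Qed.

Lemma dotvC x y : dotv x y = dotv y x.
Proof. by apply: eq_bigr => k _; rewrite mulrC. Qed.

Lemma dotvDr x y z : dotv x (y + z) = dotv x y + dotv x z.
Proof. by rewrite !dotvE mulmxDr mxE. Qed.

Lemma dotvZr a x y : dotv x (a *: y) = a * dotv x y.
Proof. by rewrite !dotvE -scalemxAr mxE. Qed.

Lemma dotvNr x y : dotv x (- y) = - dotv x y.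
Proof. by rewrite -scaleN1r dotvZr mulN1r. Qed.

Lemma dotvDl x y z : dotv (x + y) z = dotv x z + dotv y z.
Proof. by rewrite dotvC dotvDr !(dotvC z). Qed.

Lemma dotvZl a x y : dotv (a *: x) y = a * dotv x y.
Proof. by rewrite dotvC dotvZr dotvC. Qed.

Lemma dotvNl x y : dotv (- x) y = - dotv x y.
Proof. by rewrite dotvC dotvNr dotvC. Qed.

Lemma dotv_sumr {n : nat} x (y : 'I_n -> 'cV[R]_d) :
  dotv x (\sum_i y i) = \sum_i dotv x (y i).
Proof.
rewrite dotvE mulmx_sumr summxE; apply: eq_bigr => i _; exact/esym/dotvE.
Qed.

Lemma dotv_suml {n : nat} (y : 'I_n -> 'cV[R]_d) x :
  dotv (\sum_i y i) x = \sum_i dotv (y i) x.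
Proof. by rewrite dotvC dotv_sumr; apply: eq_bigr => i _; exact: dotvC. Qed.

Lemma dotv_delta (k : 'I_d) x : dotv (delta_mx k 0) x = x k 0.
Proof.
rewrite /dotv (bigD1 k) //= big1 => [|i ik].
  by rewrite mxE !eqxx mul1r addr0.
by rewrite mxE (negbTE ik) mul0r.
Qed.

Lemma dotv_ge0 x : 0 <= dotv x x.
Proof. by apply: sumr_ge0 => k _; rewrite -expr2 sqr_ge0. Qed.

Lemma enorm_sqr x : enorm x ^+ 2 = dotv x x.
Proof. by rewrite sqr_sqrtr // dotv_ge0. Qed.

Lemma enormN x : enorm (- x) = enorm x.
Proof. by rewrite /enorm dotvNl dotvNr opprK. Qed.

(** Lagrange's identity writes the difference of the two sides as half of the
    sum of the squares [(x_i y_j - x_j y_i)^2]. *)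
Lemma dotv_cauchy_schwarz x y : dotv x y ^+ 2 <= dotv x x * dotv y y.
Proof.
suff E : \sum_i \sum_j (x i 0 * y j 0 - x j 0 * y i 0) ^+ 2 =
    2 * (dotv x x * dotv y y - dotv x y ^+ 2).
  rewrite -subr_ge0 -(@pmulr_rge0 _ 2) // -E.
  by apply: sumr_ge0 => i _; apply: sumr_ge0 => j _; exact: sqr_ge0.
have prod_sum (f g : 'I_d -> R) :
    (\sum_i f i) * (\sum_j g j) = \sum_i \sum_j f i * g j.
  by rewrite mulr_suml; apply: eq_bigr => i _; rewrite mulr_sumr.
rewrite mulrBr mulrDl mul1r {2}[dotv x x * _]mulrC expr2 /dotv !prod_sum.
rewrite -big_split mulr_sumr -sumrB; apply: eq_bigr => i _.
rewrite -big_split mulr_sumr -sumrB; apply: eq_bigr => j _ /=; ring.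
Qed.

Lemma derives_within_enorm_sqr (J : set R) (t : R) (u : R -> 'cV[R]_d)
    (du : 'cV[R]_d) :
  derives_within J u t du ->
  derives_within J (fun s => enorm (u s) ^+ 2) t (2 * dotv (u t) du).
Proof.
move=> udu.
rewrite (_ : (fun s => _) = fun s => dotv (u s) (u s)); last first.
  by apply/funext => s; exact: enorm_sqr.
rewrite /dotv mulr_sumr; apply: derives_within_sum => k.
have uk := derives_within_coord (k := k) udu.
have := derives_withinM uk uk.
by congr (derives_within _ _ _ _); ring.
Qed.

End dot_product.

(** * The Landau matrix *)

Section landau_matrix.
Context {R : realType} {d : nat}.
Variables (Lambda gamma : R).
Implicit Types z b : 'cV[R]_d.

Lemma landauAN z : landauA Lambda gamma (- z) = landauA Lambda gamma z.
Proof. by rewrite /landauA enormN linearN /= mulmxN mulNmx opprK. Qed.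

Lemma landauA_mul z b :
  landauA Lambda gamma z *m b =
  (Lambda * enorm z `^ gamma) *: (dotv z z *: b - dotv z b *: z).
Proof.
rewrite /landauA -scalemxAl mulmxBl mul_scalar_mx enorm_sqr -mulmxA.
by rewrite [z^T *m b]mx11_scalar -dotvE mul_mx_scalar.
Qed.

(** As [landauA z] is symmetric, this says that [z] lies in its kernel, in the
    form in which conservation of energy uses it. *)
Lemma dotv_landauA_self z b : dotv z (landauA Lambda gamma z *m b) = 0.
Proof.
by rewrite landauA_mul dotvZr dotvDr dotvNr !dotvZr mulrC [X in _ - X]mulrC
  subrr mul0r.
Qed.

Lemma landauA_ge0 z b : 0 < Lambda ->
  0 <= dotv b (landauA Lambda gamma z *m b).
Proof.
move=> Lambda0; rewrite landauA_mul dotvZr dotvDr dotvNr !dotvZr.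
apply: mulr_ge0; first by rewrite mulr_ge0 ?powR_ge0 // ltW.
by rewrite (dotvC b z) -expr2 subr_ge0 dotv_cauchy_schwarz.
Qed.

End landau_matrix.

(** * The Gaussian kernel *)

Section gaussian.
Context {R : realType} {d : nat}.
Variables (eps : R) (eps0 : 0 < eps).
Implicit Types z : 'cV[R]_d.

Lemma psi_gt0 z : 0 < psi eps z.
Proof.
by rewrite mulr_gt0 ?expR_gt0 // powR_gt0 // mulr_gt0 // mulr_gt0 // pi_gt0.
Qed.

(** Chain rule with the explicit gradient [- psi z / eps *: z].  It is proved
    for curves before the gradient itself is computed, because the partial
    derivatives in [grad] are its instances along straight lines. *)
Lemma derives_within_psi_explicit (J : set R) (t : R) (u : R -> 'cV[R]_d)
    (du : 'cV[R]_d) :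
  derives_within J u t du ->
  derives_within J (fun s => psi eps (u s)) t
    (dotv (- (psi eps (u t) / eps) *: u t) du).
Proof.
move=> udu.
have expo : derives_within J (fun s => - (enorm (u s) ^+ 2 / (2 * eps))) t
    (- (dotv (u t) du / eps)).
  have -> : (fun s => - (enorm (u s) ^+ 2 / (2 * eps))) =
      (fun s => - (2 * eps)^-1 * enorm (u s) ^+ 2).
    by apply/funext => s; rewrite mulNr mulrC.
  have -> : - (dotv (u t) du / eps) = - (2 * eps)^-1 * (2 * dotv (u t) du).
    by field; exact: lt0r_neq0.
  exact/derives_withinZ/derives_within_enorm_sqr.
have -> : dotv (- (psi eps (u t) / eps) *: u t) du =
    (2 * pi * eps) `^ (- (d%:R / 2)) *
    (expR (- (enorm (u t) ^+ 2 / (2 * eps))) * - (dotv (u t) du / eps)).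
  by rewrite dotvZl /psi; ring.
by apply: derives_withinZ; apply: derives_within_comp expo.
Qed.

Lemma grad_psi z : grad (psi eps) z = - (psi eps z / eps) *: z.
Proof.
apply/colP => k; rewrite mxE; set e := delta_mx k 0.
rewrite -dotv_delta -/e dotvC.
have line : derives_within [set: R] (fun s => s *: e + z) 0 e.
  rewrite /derives_within.
  apply: (@cvg_trans _ (cst e @ within [set h | setT (h + 0)] 0^'));
    last exact: cvg_cst.
  apply: near_eq_cvg; apply: filterS (near_within_neq0 _ _) => h h_neq0.
  by rewrite /cst addr0 scale0r add0r addrK scalerA mulVf // scale1r.
have := derives_within_psi_explicit line; rewrite scale0r add0r.
move=> /(derives_withinP _ _ filterT) [_ <-].
rewrite /derive; do 2 f_equal; apply/funext => h /=.
by rewrite addr0 scale0r add0r [h *: 1]mulr1.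
Qed.

Lemma grad_psiN z : grad (psi eps) (- z) = - grad (psi eps) z.
Proof. by rewrite !grad_psi /psi enormN scalerN. Qed.

Lemma derives_within_psi (J : set R) (t : R) (u : R -> 'cV[R]_d)
    (du : 'cV[R]_d) :
  derives_within J u t du ->
  derives_within J (fun s => psi eps (u s)) t
    (dotv (grad (psi eps) (u t)) du).
Proof. by rewrite grad_psi; exact: derives_within_psi_explicit. Qed.

End gaussian.

(** * The particle system *)

Section particle_system.
Context {R : realType} {d N : nat}.
Variables (eps : R) (w : 'I_N -> R).
Implicit Types (v u g : 'I_N -> 'cV[R]_d).

Lemma BtildeC v i j : Btilde eps w v i j = - Btilde eps w v j i.
Proof. by rewrite opprB. Qed.

Lemma same_batchC (P : {set {set 'I_N}}) i j :
  same_batch P i j = same_batch P j i :> R.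
Proof.
rewrite /same_batch; congr (nat_of_bool _)%:R; apply: eq_existsb => B.
by rewrite (andbC (i \in B)).
Qed.

(** Weak form of the dynamics: the average over [(i, j)] and [(j, i)] turns
    [g i] into half of [g i - g j], since the interaction is antisymmetric. *)
Lemma batch_velocity_weak (Lambda gamma : R) (p : nat) (P : {set {set 'I_N}})
    v g :
  \sum_i w i * dotv (g i) (batch_velocity eps w Lambda gamma p P v i) =
  - ((N%:R - 1) / (p%:R - 1) / 2) * \sum_i \sum_j w i * w j * same_batch P i j *
    dotv (g i - g j) (landauA Lambda gamma (v i - v j) *m Btilde eps w v i j).
Proof.
set c := _ / (p%:R - 1).
pose X i j := landauA Lambda gamma (v i - v j) *m Btilde eps w v i j.
pose S := \sum_i \sum_j w i * w j * same_batch P i j * dotv (g i) (X i j).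
have XN i j : X j i = - X i j by rewrite /X BtildeC -opprB landauAN mulmxN.
have SN : S = - \sum_i \sum_j w i * w j * same_batch P i j * dotv (g j) (X i j).
  rewrite {1}/S exchange_big -sumrN; apply: eq_bigr => i _.
  rewrite -sumrN; apply: eq_bigr => j _.
  by rewrite XN dotvNr same_batchC mulrN [w j * _]mulrC.
have -> : \sum_i \sum_j w i * w j * same_batch P i j *
    dotv (g i - g j) (X i j) = 2 * S.
  rewrite mulrDl mul1r {2}SN -sumrB; apply: eq_bigr => i _.
  by rewrite -sumrB; apply: eq_bigr => j _; rewrite dotvDl dotvNl mulrBr.
rewrite mulNr mulrA divfK // /S mulr_sumr -sumrN; apply: eq_bigr => i _.
rewrite dotvNr dotvZr dotv_sumr mulrN mulrCA; congr (- (_ * _)).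
rewrite mulr_sumr; apply: eq_bigr => j _.
by rewrite dotvZr !mulrA.
Qed.

Lemma grad_dE_batch_velocity (Lambda gamma : R) (p : nat)
    (P : {set {set 'I_N}}) v :
  \sum_i w i * dotv (grad_dE eps w v (v i))
                    (batch_velocity eps w Lambda gamma p P v i) =
  - dissipation eps w Lambda gamma p P v.
Proof.
rewrite batch_velocity_weak mulNr /dissipation; congr (- (_ * _)).
by rewrite invfM mulrA mulrAC.
Qed.

Hypotheses (eps0 : 0 < eps) (w0 : forall i, 0 < w i).

Lemma density_gt0 v (i : 'I_N) : 0 < density eps w v (v i).
Proof.
have term_gt0 k : 0 < w k * psi eps (v i - v k).
  by apply: mulr_gt0; [exact: w0|exact: psi_gt0].
rewrite /density (bigD1 i) //= ltr_pwDl //.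
by apply: sumr_ge0 => k _; exact: ltW.
Qed.

(** The left side is what the chain rule gives for the time derivative of the
    entropy along velocities [u].  In the terms with [u k] the indices are
    exchanged; [grad psi] being odd, they recombine with those in [u i] to the
    two sums of [grad_dE]. *)
Lemma entropy_variation v u :
  \sum_i w i * ((density eps w v (v i))^-1 * \sum_k w k *
    dotv (grad (psi eps) (v i - v k)) (u i - u k)) =
  \sum_i w i * dotv (grad_dE eps w v (v i)) (u i).
Proof.
pose G i k := grad (psi eps) (v i - v k).
pose r i := (density eps w v (v i))^-1.
have GN i k : G k i = - G i k by rewrite /G -opprB grad_psiN.
transitivity (\sum_i \sum_k w i * r i * w k * dotv (G i k) (u i) -
              \sum_i \sum_k w i * r i * w k * dotv (G i k) (u k)).
  rewrite -sumrB; apply: eq_bigr => i _.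
  rewrite mulrA mulr_sumr -sumrB; apply: eq_bigr => k _.
  by rewrite dotvDr dotvNr mulrA mulrBr.
rewrite [X in _ - X]exchange_big -sumrB; apply: eq_bigr => i _.
rewrite /grad_dE dotvDl dotvZl !dotv_suml mulrDr !mulr_sumr -sumrB -big_split.
apply: eq_bigr => k _ /=.
rewrite (GN i k) dotvNl !dotvZl -/(G i k) -/(r i) -/(r k); ring.
Qed.

Lemma derives_within_entropy (J : set R) (t : R) (v : 'I_N -> R -> 'cV[R]_d) u :
  (forall i, derives_within J (v i) t (u i)) ->
  derives_within J (fun s => entropy eps w (v ^~ s)) t
    (\sum_i w i * dotv (grad_dE eps w (v ^~ t) (v i t)) (u i)).
Proof.
move=> vu; rewrite -(entropy_variation (v ^~ t)).
apply: derives_within_sum => i; apply: derives_withinZ.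
apply: (derives_within_comp (f := fun s => density eps w (v ^~ s) (v i s))).
  exact/is_derive1_ln/(density_gt0 (v ^~ t)).
apply: derives_within_sum => k; apply: derives_withinZ.
apply: (derives_within_psi eps0 (u := fun s => v i s - v k s)).
by apply: derives_withinB; exact: vu.
Qed.

Lemma dissipation_ge0 (Lambda gamma : R) (p : nat) (P : {set {set 'I_N}}) v :
  0 < Lambda -> (2 <= p <= N)%N -> 0 <= dissipation eps w Lambda gamma p P v.
Proof.
move=> Lambda0 /andP[p2 pN].
have p1 : 1 <= p%:R :> R by rewrite ler1n ltnW.
have N1 : 1 <= N%:R :> R by rewrite ler1n (leq_trans _ pN) // ltnW.
apply: mulr_ge0.
  by rewrite divr_ge0 ?mulr_ge0 // subr_ge0.
apply: sumr_ge0 => i _; apply: sumr_ge0 => j _.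
apply: mulr_ge0; last exact: landauA_ge0.
by rewrite !mulr_ge0 ?ler0n ?ltW.
Qed.

End particle_system.

Theorem proposition3p4 (R : realType) (d N p : nat)
    (Lambda gamma eps : R) (w : 'I_N -> R) (P : {set {set 'I_N}})
    (J : set R) (v : 'I_N -> R -> 'cV[R]_d) :
  (2 <= d)%N -> 0 < Lambda -> - d%:R - 1 <= gamma <= 1 -> 0 < eps ->
  (forall i, 0 < w i) ->
  (2 <= p <= N)%N -> (p %| N)%N -> is_batching p P ->
  is_interval J ->
  (forall i t, J t ->
    derives_within J (v i) t
      (batch_velocity eps w Lambda gamma p P (v ^~ t) i)) ->
  (forall t, J t ->
    [/\ derives_within J (fun s => \sum_i w i * 1) t (0 : R),
        derives_within J (fun s => \sum_i w i *: v i s) t 0 &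
        derives_within J (fun s => \sum_i w i * enorm (v i s) ^+ 2) t (0 : R)])
  /\
  (forall t, J t ->
    derives_within J (fun s => entropy eps w (v ^~ s)) t
      (- dissipation eps w Lambda gamma p P (v ^~ t)) /\
    - dissipation eps w Lambda gamma p P (v ^~ t) <= 0).
Proof.
move=> _ Lambda0 _ eps0 w0 pN _ _ _ ode; split=> t Jt; last first.
  split; last by rewrite oppr_le0 dissipation_ge0.
  rewrite -grad_dE_batch_velocity; apply: derives_within_entropy => // i.
  exact: ode.
set u := batch_velocity eps w Lambda gamma p P (v ^~ t).
split.
- rewrite /derives_within; under eq_fun do rewrite subrr scaler0.
  exact: cvg_cst.
- have E : \sum_i w i *: u i = 0.
    apply/colP => k; rewrite -dotv_delta dotv_sumr mxE.
    under eq_bigr do rewrite dotvZr.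
    (* Each coordinate is a constant test vector. *)
    rewrite (batch_velocity_weak _ _ _ _ _ _ _ (fun=> delta_mx k 0)).
    rewrite big1 ?mulr0 // => i _; rewrite big1 // => j _.
    by rewrite subrr -[0](scale0r (0 : 'cV[R]_d)) dotvZl mul0r mulr0.
  rewrite -[X in derives_within _ _ _ X]E.
  by apply: derives_within_sum => i; apply: derives_withinZ; exact: ode.
- have E : \sum_i w i * (2 * dotv (v i t) (u i)) = 0.
    under eq_bigr do rewrite mulrCA.
    rewrite -mulr_sumr (batch_velocity_weak _ _ _ _ _ _ _ (v ^~ t)).
    rewrite big1 ?mulr0 // => i _; rewrite big1 // => j _.
    by rewrite dotv_landauA_self mulr0.
  rewrite -[X in derives_within _ _ _ X]E.
  apply: derives_within_sum => i; apply: derives_withinZ.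
  by apply: derives_within_enorm_sqr; exact: ode.
Qed.
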